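(* Let $\mathfrak{a}$ be an ideal of $\mathbb{Z}[x_1,\ldots,x_n]$. Every ideal in $\mathbb{Z}[x_1,\ldots,x_n]/\mathfrak{a}$ is an ideal lattice if and only if $\mathbb{Z}[x_1,\ldots,x_n]/\mathfrak{a}$ is a free and finitely generated $\mathbb{Z}$-module.
   Context: An integer lattice is an additive subgroup of $\mathbb{Z}^N$ for some $N\in\mathbb{N}$. An ideal $\mathfrak{A}$ of $\mathbb{Z}[x_1,\ldots,x_n]/\mathfrak{a}$ is called a (multivariate) ideal lattice if it is isomorphic, as a $\mathbb{Z}$-module, to an integer lattice $\mathcal{L}\subseteq\mathbb{Z}^N$ for some $N$. *)

(* Defs.v *)
From HB Require Import structures.
From mathcomp Require Import all_boot all_algebra.
From mathcomp Require Import boolp classical_sets.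
From mathcomp Require Import mpoly.

Set Implicit Arguments.
Unset Strict Implicit.
Unset Printing Implicit Defensive.

Import GRing.Theory.
Import Quotient.Exports.
Local Open Scope ring_scope.
Local Open Scope quotient_scope.

Record subgroup (V : zmodType) := Subgroup {
  subgroup_mem :> V -> Prop;
  subgroup0 : subgroup_mem 0;
  subgroupB : forall x y,
    subgroup_mem x -> subgroup_mem y -> subgroup_mem (x - y)
}.

(* Unlike the library's [idealr], an ideal may be the whole ring. *)
Record ideal (R : comPzRingType) := Ideal {
  ideal_subgroup :> subgroup R;
  idealM : forall a x, ideal_subgroup x -> ideal_subgroup (a * x)
}.

(* The boolean predicate needed by [zmodClosed], obtained classically. *)
Definition subgroup_pred (V : zmodType) (S : subgroup V) : {pred V} :=
  fun x => `[< S x >].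

Lemma subgroup_predP (V : zmodType) (S : subgroup V) (x : V) :
  reflect (S x) (x \in subgroup_pred S).
Proof. exact: asboolP. Qed.

Lemma subgroup_pred_closed (V : zmodType) (S : subgroup V) :
  zmod_closed (subgroup_pred S).
Proof.
split=> [|x y /subgroup_predP Sx /subgroup_predP Sy]; apply/subgroup_predP.
  exact: subgroup0.
exact: subgroupB.
Qed.

HB.instance Definition _ (V : zmodType) (S : subgroup V) :=
  GRing.isZmodClosed.Build V (subgroup_pred S) (subgroup_pred_closed S).

Definition subgroup_type (V : zmodType) (S : subgroup V) : Type :=
  {x : V | x \in subgroup_pred S}.

HB.instance Definition _ (V : zmodType) (S : subgroup V) :=
  SubChoice.on (subgroup_type S).
HB.instance Definition _ (V : zmodType) (S : subgroup V) :=
  [SubChoice_isSubZmodule of subgroup_type S by <:].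

Section QuotientRing.
Variables (R : comPzRingType) (I : ideal R).

Definition quotient_ring : Type := Quotient.quot (subgroup_pred I).

HB.instance Definition _ := ZmodQuotient.on quotient_ring.

Definition quotient_one : quotient_ring := \pi_quotient_ring 1.
Definition quotient_mul := lift_op2 quotient_ring *%R.

Lemma quotient_piE (x y : R) :
  \pi_quotient_ring x = \pi_quotient_ring y <-> I (x - y).
Proof.
by split=> [/eqP|Ixy]; [|apply/eqP]; rewrite -Quotient.idealrBE;
  [move/subgroup_predP | apply/subgroup_predP].
Qed.

Lemma quotient_piD :
  {morph \pi_quotient_ring : x y / x + y >-> x + y}.
Proof. exact: pi_addr. Qed.

Lemma quotient_piM :
  {morph \pi_quotient_ring : x y / x * y >-> quotient_mul x y}.
Proof.
move=> x y; unlock quotient_mul; apply/quotient_piE.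
have Irepr z : I (z - repr (\pi_quotient_ring z)).
  by apply/quotient_piE; rewrite reprK.
set x' := repr _; set y' := repr _.
have -> : x * y - x' * y' = y * (x - x') - x' * (y' - y).
  by rewrite !mulrBr opprB [y * x]mulrC [y * x']mulrC addrA subrK.
apply: subgroupB; apply: idealM; first exact: Irepr.
by rewrite -[_ - _]opprB -sub0r; apply: subgroupB (Irepr y); apply: subgroup0.
Qed.

Lemma quotient_mulA : associative quotient_mul.
Proof.
move=> u v w; rewrite -[u]reprK -[v]reprK -[w]reprK.
by rewrite -!quotient_piM mulrA.
Qed.

Lemma quotient_mulC : commutative quotient_mul.
Proof. by move=> u v; unlock quotient_mul; rewrite mulrC. Qed.

Lemma quotient_mul1 : left_id quotient_one quotient_mul.
Proof. by move=> u; rewrite -[u]reprK -quotient_piM mul1r. Qed.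

Lemma quotient_mulDl : left_distributive quotient_mul +%R.
Proof.
move=> u v w; rewrite -[u]reprK -[v]reprK -[w]reprK.
by rewrite -quotient_piD -!quotient_piM -quotient_piD mulrDl.
Qed.

HB.instance Definition _ := GRing.Zmodule_isComPzRing.Build quotient_ring
  quotient_mulA quotient_mulC quotient_mul1 quotient_mulDl.

End QuotientRing.

Section Modules.
Variable R : pzRingType.

Definition module_isomorphic (M N : lmodType R) : Prop :=
  exists f : {linear M -> N}, bijective f.

Definition generates (M : lmodType R) (B : set M) : Prop :=
  forall x : M, exists (s : seq M) (c : M -> R),
    (forall b, b \in s -> B b) /\ x = \sum_(b <- s) c b *: b.

Definition linearly_independent (M : lmodType R) (B : set M) : Prop :=
  forall (s : seq M) (c : M -> R),
    uniq s -> (forall b, b \in s -> B b) ->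
    \sum_(b <- s) c b *: b = 0 -> forall b, b \in s -> c b = 0.

Definition finitely_generated (M : lmodType R) : Prop :=
  exists s : seq M, generates [set` s].

Definition free_module (M : lmodType R) : Prop :=
  exists B : set M, linearly_independent B /\ generates B.

End Modules.

Definition integer_lattice (N : nat) := subgroup 'rV[int]_N.

(* [zmodule M] is the abelian group [M] with its [int]-module structure. *)
Definition ideal_lattice (R : comPzRingType) (J : ideal R) : Prop :=
  exists (N : nat) (L : integer_lattice N),
    module_isomorphic (zmodule (subgroup_type J)) (zmodule (subgroup_type L)).

(* Main.v *)
(* The whole ring is one of its ideals, so the forward direction says that a
   subgroup of Z^N is free of finite rank.  Conversely, an isomorphism of the
   quotient ring with Z^k embeds each of its ideals in Z^k. *)
From HB Require Import structures.
Require Import Defs.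
From mathcomp Require Import all_boot all_order all_algebra.
From mathcomp Require Import boolp classical_sets.
From mathcomp Require Import mpoly.

Set Implicit Arguments.
Unset Strict Implicit.
Unset Printing Implicit Defensive.

Import Order.TTheory GRing.Theory Num.Theory.
Local Open Scope ring_scope.

(** * Isomorphisms of modules *)

Lemma inj_surj_bijective (A B : Type) (f : A -> B) :
  injective f -> (forall y, exists x, f x = y) -> bijective f.
Proof. by move=> f_inj /choice[g gK]; exists g => // x; apply: f_inj. Qed.

Lemma module_isomorphic_sym (R : pzRingType) (M N : lmodType R) :
  module_isomorphic M N -> module_isomorphic N M.
Proof.
move=> [f [g fK gK]].
pose G := GRing.isLinear.Build R N M *:%R g (can2_linear fK gK).
pose g' : {linear N -> M} := HB.pack g G.
by exists g'; exists f.
Qed.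

Lemma module_isomorphic_trans (R : pzRingType) (L M N : lmodType R) :
  module_isomorphic L M -> module_isomorphic M N -> module_isomorphic L N.
Proof.
by move=> [f f_bij] [g g_bij]; exists (g \o f : {linear L -> N}); apply: bij_comp.
Qed.

(** An additive map commutes with integer multiples, so it is already linear over the integers. *)
Lemma zmodule_isomorphic (U : zmodType) (V : lmodType int)
    (f : {additive U -> V}) :
  bijective f -> module_isomorphic (zmodule U) V.
Proof.
move=> f_bij.
have f_scalable : scalable (f : zmodule U -> V).
  by move=> m x; rewrite scalezrE raddfMz -scaler_int intz.
pose F : {linear zmodule U -> V} := HB.pack (f : zmodule U -> V)
  (GRing.Additive.on f) (GRing.isScalable.Build int (zmodule U) V *:%R f f_scalable).
by exists F.
Qed.

(** * Free modules of finite rank *)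

Section FreeModules.
Variables (R : nzRingType) (M : lmodType R).

(** The images [e i] of the standard unit vectors form a finite basis of [M]. *)
Lemma rV_isomorphic_free_fg (k : nat) :
  module_isomorphic 'rV[R]_k M -> free_module M /\ finitely_generated M.
Proof.
move=> [g [h gK hK]]; pose e i := g (delta_mx 0 i : 'rV_k).
have e_inj : injective e.
  move=> i j /(can_inj gK)/matrixP/(_ 0 i)/eqP.
  (* Coordinate [i] of two different unit vectors would give 1 = 0, which is excluded in a
     nontrivial ring. *)
  by rewrite !mxE !eqxx; have [//|_] := eqVneq i j; rewrite oner_eq0.
have e_gen : generates [set` codom e].
  (* Coefficients are indexed by elements of [M]; since [e] is injective, the sum defining [c (e i)]
     reduces to coordinate [i] of [h x]. *)
  move=> x; pose c b := \sum_(i | e i == b) h x 0 i.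
  exists (codom e), c; split=> //.
  rewrite big_image /= -[LHS]hK [h x in LHS]row_sum_delta linear_sum /=.
  apply: eq_bigr => i _; rewrite linearZ /c /=; congr (_ *: _).
  by rewrite (eq_bigl (pred1 i)) ?big_pred1_eq // => j; rewrite (inj_eq e_inj).
split; last by exists (codom e).
exists [set` codom e]%classic; split=> // s c s_uniq s_sub s0 b bs.
have /codomP[i b_def] : b \in codom e by apply: s_sub.
have h_lin : linear h := can2_linear gK hK.
(* The inverse [h] turns the relation into one between unit vectors, whose coordinate [i] isolates
   [c b]. *)
have : \sum_(d <- s) c d *: h d = 0.
  apply: (can_inj gK); rewrite linear_sum linear0 -[RHS]s0.
  by apply: eq_bigr => d _; rewrite linearZ hK.
move/matrixP/(_ 0 i); rewrite summxE (bigD1_seq b) //= !mxE b_def gK mxE !eqxx.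
rewrite mulr1 big_seq_cond big1 ?addr0 // => d /andP[/s_sub/codomP[j ->]].
rewrite (inj_eq e_inj) eq_sym !mxE gK mxE eqxx => /negPf ->.
by rewrite mulr0.
Qed.

(** Each of the finitely many generators expands over finitely many elements of [B]. The list [u] of
    all these elements is a finite basis, even if [B] is not known to be finite. *)
Lemma free_fg_rV_isomorphic :
  free_module M -> finitely_generated M ->
  exists k, module_isomorphic 'rV[R]_k M.
Proof.
move=> [B [B_free B_gen]] [s s_gen].
have /choice[t /choice[c tcP]] := B_gen.
(* Independence of [B] speaks only of lists without duplicates, hence [undup]. *)
pose u := undup (flatten [seq t b | b <- s]).
have uB b : b \in u -> B b.
  by rewrite mem_undup => /flattenP[_ /mapP[d _ ->]]; apply: (tcP d).1.
pose e (i : 'I_(size u)) := u`_i.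
pose g (v : 'rV[R]_(size u)) := \sum_i v 0 i *: e i.
have g_lin : linear g.
  move=> a v w; rewrite scaler_sumr -big_split /=; apply: eq_bigr => i _.
  by rewrite !mxE scalerDl scalerA.
pose G : {linear 'rV[R]_(size u) -> M} :=
  HB.pack g (GRing.isLinear.Build R _ _ _ g g_lin).
exists (size u), G; apply: inj_surj_bijective.
  apply: raddf_inj => v gv0; apply/rowP => i; rewrite mxE.
  (* [d] moves the coefficients from positions in [u] to elements of [M]; the entries of [u] are
     distinct, so each sum has at most one term. *)
  pose d b := \sum_(j | e j == b) v 0 j.
  have de j : d (e j) = v 0 j.
    rewrite /d (eq_bigl (pred1 j)) ?big_pred1_eq // => j' /=.
    by rewrite nth_uniq // undup_uniq.
  rewrite -de; apply: (B_free u) => //; [exact: undup_uniq| |exact: mem_nth].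
  rewrite -[RHS]gv0 (big_nth 0) big_mkord; apply: eq_bigr => j _.
  by rewrite de.
(* The range of [G] is closed under linear combinations. This is applied first to the generators in
   [s], then to the expansion of each generator over [B]. *)
have img_sum r (a : M -> R) : (forall b, b \in r -> exists v, G v = b) ->
    exists v, G v = \sum_(b <- r) a b *: b.
  move=> rG; rewrite big_seq; elim/big_ind: _.
  - by exists 0; rewrite linear0.
  - by move=> _ _ [v <-] [w <-]; exists (v + w); rewrite linearD.
  - by move=> b /rG[v Gv]; exists (a b *: v); rewrite linearZ; congr (_ *: _).
move=> x; have [a [b [/= a_sub ->]]] := s_gen x.
apply: (img_sum) => {}x /a_sub xs; rewrite (tcP x).2; apply: (img_sum) => y yt.
have yu : y \in u by rewrite mem_undup; apply/flattenP; exists (t x); rewrite ?map_f.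
have lt_i : (index y u < size u)%N by rewrite index_mem.
exists (delta_mx 0 (Ordinal lt_i)); rewrite /G /= /g (bigD1 (Ordinal lt_i)) //=.
rewrite big1 => [|j /negPf ji]; last by rewrite mxE ji scale0r.
by rewrite mxE !eqxx scale1r addr0 /e nth_index.
Qed.

End FreeModules.

(** * Subgroups of Z and of Z^N *)

Lemma subgroupN (V : zmodType) (S : subgroup V) x : S x -> S (- x).
Proof. by move=> Sx; rewrite -sub0r; apply: subgroupB => //; apply: subgroup0. Qed.

Lemma subgroupD (V : zmodType) (S : subgroup V) x y : S x -> S y -> S (x + y).
Proof. by move=> Sx Sy; rewrite -[y]opprK; apply/subgroupB/subgroupN. Qed.

Lemma subgroupMz (V : zmodType) (S : subgroup V) x m : S x -> S (x *~ m).
Proof.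
move=> Sx; have SMn n : S (x *+ n).
  elim: n => [|n IHn]; first exact: subgroup0.
  by rewrite mulrS; apply: subgroupD.
by case: m => n; [apply: SMn | apply: subgroupN; apply: SMn].
Qed.

(** In a nonzero subgroup, [d] is the least positive element: the remainder of a member modulo [d]
    stays in the subgroup and is smaller than [d], so it is zero. For the zero subgroup, [d] is
    0. *)
Lemma int_subgroup_principal (S : subgroup int) :
  exists2 d, S d & forall x, S x -> (d %| x)%Z.
Proof.
have [S0|/existsNP[x /not_implyP[Sx x0]]] := pselect (forall x, S x -> x = 0).
  by exists 0 => [|x /S0->]; [exact: subgroup0|rewrite dvdz0].
have Spos : exists m : nat, (0 < m)%N && `[< S m >].
  exists `|x|%N; rewrite absz_gt0; apply/andP; split; first exact/eqP.
  apply/asboolP; rewrite abszE; case: (ger0P x) => // _; exact: subgroupN.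
case: (ex_minnP Spos) => d /andP[d_gt0 /asboolP Sd] d_min.
exists (Posz d) => // y Sy; apply/dvdz_mod0P/eqP; apply: contraT => r0.
have Sr : S (y %% d)%Z.
  by rewrite /modz mulrC -mulrzz; apply/subgroupB/subgroupMz.
have r_ge0 : 0 <= (y %% d)%Z by rewrite modz_ge0 // -lt0n.
have : (d <= `|(y %% d)%Z|)%N.
  by apply: d_min; rewrite absz_gt0 r0; apply/asboolP; rewrite gez0_abs.
by rewrite leqNgt -ltz_nat gez0_abs // ltz_pmod.
Qed.

(* Induction on N: the first coordinates of L form an ideal dZ, and a basis of
   the sublattice with zero first coordinate is completed, if d <> 0, by any
   vector of L with first coordinate d. *)
Lemma lattice_basis (N : nat) (L : integer_lattice N) :
  exists k (B : 'M[int]_(k, N)),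
    (forall x, L x <-> exists v, x = v *m B) /\
    (forall v : 'rV_k, v *m B = 0 -> v = 0).
Proof.
elim: N L => [|N IHN] L.
  exists 0%N, 0; split=> [x|v _]; last by apply/rowP; case.
  have -> : x = 0 by apply/rowP; case.
  by split=> [_|_]; [exists 0; rewrite mul0mx|exact: subgroup0].
(* The width is written [1 + N], convertible with [N.+1], so that block operations apply. *)
pose vec (h : int) (y : 'rV_N) : 'rV_(1 + N) := row_mx (h%:M : 'M_1) y.
have vec0 : vec 0 0 = 0 by rewrite /vec raddf0 row_mx0.
have vecB h h' y y' : vec h y - vec h' y' = vec (h - h') (y - y').
  by rewrite /vec opp_row_mx add_row_mx raddfB.
have vecP (x : 'rV_(1 + N)) : exists h y, x = vec h y.
  exists (lsubmx x 0 0), (rsubmx x).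
  by rewrite /vec -mx11_scalar hsubmxK.
have L0_0 : L (vec 0 0) by rewrite vec0; exact: subgroup0.
have L0_B y y' : L (vec 0 y) -> L (vec 0 y') -> L (vec 0 (y - y')).
  by move=> Ly Ly'; rewrite -[0]subr0 -vecB; apply: subgroupB.
have S_0 : exists y, L (vec 0 y) by exists 0.
have S_B h h' : (exists y, L (vec h y)) -> (exists y, L (vec h' y)) ->
    exists y, L (vec (h - h') y).
  by move=> [y Ly] [y' Ly']; exists (y - y'); rewrite -vecB; apply: subgroupB.
pose L0 : integer_lattice N := @Subgroup _ (fun y => L (vec 0 y)) L0_0 L0_B.
pose S : subgroup int := @Subgroup _ (fun h => exists y, L (vec h y)) S_0 S_B.
have [k [B [B_span B_free]]] := IHN L0.
have [d [w Lw] d_dvd] := int_subgroup_principal S.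
have vec_eq h h' y y' : vec h y = vec h' y' -> h = h' /\ y = y'.
  move=> /(@eq_row_mx _ 1 1 N)[/matrixP/(_ 0 0)].
  by rewrite !mxE !mulr1n.
have mulB (v : 'rV_k) : v *m (row_mx 0 B : 'M_(k, 1 + N)) = vec 0 (v *m B).
  by rewrite mul_mx_row mulmx0 /vec raddf0.
have [d0|d_neq0] := eqVneq d 0.
  (* All first coordinates vanish here, so [L] is [L0] with a zero column put in front. *)
  exists k, (row_mx 0 B : 'M_(k, 1 + N)); split=> [x|v].
    split=> [Lx|[v ->]]; last by rewrite mulB; apply/B_span; exists v.
    have [h [y x_def]] := vecP x; rewrite {}x_def in Lx *.
    have h0 : h = 0.
      by apply/eqP; rewrite -dvd0z -d0; apply: d_dvd; exists y.
    rewrite {}h0 in Lx *; have [v ->] : exists v, y = v *m B by apply/B_span.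
    by exists v; rewrite mulB.
  by rewrite mulB -vec0 => /vec_eq[_ /B_free].
pose B1 : 'M[int]_(1 + k, 1 + N) := col_mx (vec d w) (row_mx 0 B).
have vec_comb c y : vec d w *~ c + vec 0 y = vec (c * d) (c *: w + y).
  rewrite -scaler_int intz /vec scale_row_mx scale_scalar_mx add_row_mx.
  by rewrite raddf0 addr0.
have mulB1 (c : int) (v : 'rV_k) :
    row_mx (c%:M : 'M_1) v *m B1 = vec d w *~ c + vec 0 (v *m B).
  by rewrite mul_row_col mulB mul_scalar_mx -scaler_int intz.
exists (1 + k)%N, B1; split=> [x|v].
  split=> [Lx|[v ->]].
    have [h [y x_def]] := vecP x; rewrite {}x_def in Lx *.
    have /dvdzP[c h_def] : (d %| h)%Z by apply: d_dvd; exists y.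
    (* Subtracting [c] times [vec d w] cancels the first coordinate [h = c * d] and leaves a vector
       of [L0]. *)
    have /B_span[v v_def] : L0 (y - c *: w).
      change (L (vec 0 (y - c *: w))).
      have <- : vec h y - vec d w *~ c = vec 0 (y - c *: w).
        have := vec_comb c 0; rewrite vec0 !addr0 => ->.
        by rewrite vecB h_def subrr.
      by apply/subgroupB/subgroupMz.
    exists (row_mx (c%:M : 'M_1) v).
    by rewrite mulB1 vec_comb h_def -v_def addrC subrK.
  rewrite -[v]hsubmxK [lsubmx v]mx11_scalar mulB1.
  apply: subgroupD; first exact: subgroupMz.
  by apply/B_span; exists (rsubmx v).
(* The first coordinate of a vanishing combination is [d] times the coefficient of [vec d w]. As [d]
   is nonzero, that coefficient is 0, and [B_free] handles the others. *)
rewrite -[v]hsubmxK [lsubmx v]mx11_scalar mulB1 vec_comb -vec0.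
move=> /vec_eq[/eqP]; rewrite mulf_eq0 (negPf d_neq0) orbF => /eqP->.
by rewrite scale0r add0r => /B_free ->; rewrite raddf0 row_mx0.
Qed.

(** The rows of [B] are a basis of [L], so sending [v] to [v *m B] is a bijection onto [L]; its
    inverse reads off coordinates. *)
Lemma lattice_rV_isomorphic (N : nat) (L : integer_lattice N) :
  exists k, module_isomorphic (zmodule (subgroup_type L)) 'rV[int]_k.
Proof.
have [k [B [B_span B_free]]] := lattice_basis L.
have BL (v : 'rV_k) : v *m B \in subgroup_pred L.
  by apply/subgroup_predP/B_span; exists v.
pose g (v : 'rV[int]_k) : subgroup_type L := Sub (v *m B) (BL v).
have g_additive : {morph g : x y / x - y}.
  by move=> x y; apply: val_inj; rewrite raddfB /= mulmxBl.
have g_bij : bijective g.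
  apply: inj_surj_bijective => [x y /(congr1 val)/= /eqP|[x Lx]].
    rewrite -subr_eq0 -mulmxBl => /eqP/B_free/eqP.
    by rewrite subr_eq0 => /eqP.
  have /subgroup_predP/B_span[v v_def] := Lx.
  by exists v; apply: val_inj; rewrite /= v_def.
have [f gK fK] := g_bij; exists k.
have f_additive : {morph f : x y / x - y}.
  by move=> x y; apply: (can_inj gK); rewrite fK g_additive !fK.
pose F : {additive subgroup_type L -> 'rV[int]_k} :=
  HB.pack f (GRing.isZmodMorphism.Build _ _ f f_additive).
by apply: (@zmodule_isomorphic _ _ F); exists g.
Qed.

(** The lattice is the image of [S] under [f]; injectivity makes the restriction of [f] a bijection
    onto it. *)
Lemma subgroup_embedding_lattice (V : zmodType) (S : subgroup V) (N : nat)
    (f : {additive V -> 'rV[int]_N}) :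
  injective f ->
  exists L : integer_lattice N,
    module_isomorphic (zmodule (subgroup_type S)) (zmodule (subgroup_type L)).
Proof.
move=> f_inj; pose T v := exists2 x, S x & v = f x.
have T0 : T 0 by exists 0; rewrite ?raddf0 //; exact: subgroup0.
have TB x y : T x -> T y -> T (x - y).
  move=> [x' Sx ->] [y' Sy ->]; exists (x' - y'); rewrite ?raddfB //.
  exact: subgroupB.
pose L : integer_lattice N := Subgroup T0 TB; exists L.
have fL (x : subgroup_type S) : f (val x) \in subgroup_pred L.
  by apply/subgroup_predP; exists (val x) => //; apply/subgroup_predP/valP.
pose g (x : subgroup_type S) : subgroup_type L := Sub (f (val x)) (fL x).
have g_additive : {morph g : x y / x - y}.
  by move=> x y; apply: val_inj; rewrite /= !raddfB.
pose G : {additive subgroup_type S -> zmodule (subgroup_type L)} :=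
  HB.pack g (GRing.isZmodMorphism.Build _ _ g g_additive).
apply: (@zmodule_isomorphic _ _ G); apply: inj_surj_bijective => [x y|[v Lv]].
  by move=> /(congr1 val)/f_inj/val_inj.
have /subgroup_predP[x Sx v_def] := Lv.
have xS : x \in subgroup_pred S by apply/subgroup_predP.
by exists (Sub x xS); apply: val_inj; rewrite /= v_def.
Qed.

(** * The whole ring as an ideal, and the equivalence *)

Definition full_ideal (R : comPzRingType) : ideal R :=
  @Ideal R (@Subgroup R (fun=> True) I (fun _ _ _ _ => I)) (fun _ _ _ => I).

Lemma full_ideal_isomorphic (R : comPzRingType) :
  module_isomorphic (zmodule (subgroup_type (full_ideal R))) (zmodule R).
Proof.
apply: (@zmodule_isomorphic _ _
  (val : {additive subgroup_type (full_ideal R) -> zmodule R})).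
apply: inj_surj_bijective => [|x]; first exact: val_inj.
have xR : x \in subgroup_pred (full_ideal R) by apply/subgroup_predP.
by exists (Sub x xR).
Qed.

Theorem corollary4p7 (n : nat) (a : ideal {mpoly int[n]}) :
  (forall J : ideal (quotient_ring a), ideal_lattice J) <->
  (free_module (zmodule (quotient_ring a)) /\ finitely_generated (zmodule (quotient_ring a))).
Proof.
split=> [/(_ (full_ideal _))[N [L iso_L]]|[Q_free Q_fg] J].
  have [k iso_k] := lattice_rV_isomorphic L.
  (* The quotient ring is isomorphic to its full ideal, hence to [L], hence to Z^k. *)
  apply: (@rV_isomorphic_free_fg _ _ k); apply: module_isomorphic_sym.
  apply: module_isomorphic_trans iso_k; apply: module_isomorphic_trans iso_L.
  exact/module_isomorphic_sym/full_ideal_isomorphic.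
have [k /module_isomorphic_sym[f /bij_inj f_inj]] := free_fg_rV_isomorphic Q_free Q_fg.
exists k; exact: (@subgroup_embedding_lattice (quotient_ring a) J k f f_inj).
Qed.
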